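(* Let $M$ be a $(2n+1)$-dimensional manifold and let $\mathcal J=(F,\eta,\pi,\theta,\varphi)$ represent a generalized contact structure on $M$ associated to a classical contact 1-form $\eta$. Then the corresponding bundles $L$ and $\overline L$ are Dirac structures. The bundles $L^*$ and $\overline L^*$ are never Dirac structures. In particular, the pair $L$ and $L^*$ is not a Lie bialgebroid.
   Context: Setting: on sections of $TM\oplus T^*M$ put $\langle X+\alpha,Y+\beta\rangle=\frac12(\iota_X\beta+\iota_Y\alpha)$ and the Courant bracket $[\![X+\alpha,Y+\beta]\!]=[X,Y]+\mathcal L_X\beta-\mathcal L_Y\alpha-\frac12 d(\iota_X\beta-\iota_Y\alpha)$. Both are extended complex-linearly to $(TM\oplus T^*M)_{\mathbb C}$, and the anchor $\rho$ is the projection onto $TM_{\mathbb C}$. For a 2-form $\theta$, $\theta^\flat X=\theta(X,\cdot)$; for a bivector field $\pi$, $(\pi^\sharp\alpha)(\beta)=\pi(\alpha,\beta)$. Generalized (almost) contact structures: a generalized almost contact pair on an odd-dimensional manifold $M$ is a bundle endomorphism $\Phi$ of $TM\oplus T^*M$ and a section $F+\eta$ of $TM\oplus T^*M$ with $\Phi+\Phi^*=0$, $\eta(F)=1$, $\Phi(F)=0$, $\Phi(\eta)=0$ and $\Phi\circ\Phi=-\mathbb I+F\odot\eta$, where $(F\odot\eta)(X+\alpha)=\eta(X)F+\alpha(F)\eta$. Pairs $(\Phi,F+\eta)$ and $(\Phi,\frac1fF+f\eta)$, with $f$ a function without zeros, are equivalent, and a generalized almost contact structure is an equivalence class. It is represented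 by tensors $(F,\eta,\pi,\theta,\varphi)$ ($\pi$ a bivector field, $\theta$ a 2-form, $\varphi$ a $(1,1)$-tensor) with $\Phi=\begin{pmatrix}\varphi&\pi^\sharp\\ \theta^\flat&-\varphi^*\end{pmatrix}$. It is called a generalized contact structure if the space of sections $\Gamma(L)$ of the bundle $L$ defined below is closed under the Courant bracket. The structure associated to a contact 1-form: a contact 1-form on the $(2n+1)$-dimensional manifold $M$ is a 1-form $\eta$ with $\eta\wedge(d\eta)^n\neq0$ everywhere. Put $\theta=d\eta$; then $\flat(X)=\iota_X\theta-\eta(X)\eta$ is an isomorphism $TM\to T^*M$; $F$ is the Reeb field, the unique vector field with $\iota_F\eta=1$, $\iota_Fd\eta=0$; $\pi(\alpha,\beta)=\theta(\flat^{-1}(\alpha),\flat^{-1}(\beta))$; $\varphi=0$; $\Phi=\begin{pmatrix}0&\pi^\sharp\\ \theta^\flat&0\end{pmatrix}$. Bundles: $\ker\eta\subset TM$ and $\ker F=\{\alpha\in T^*M:\alpha(F)=0\}$; $L_F$ and $L_\eta$ are the complex line bundles spanned by $F$ and $\eta$; $E^{(1,0)}=\{e-i\Phi(e): e\in\ker\eta\oplus\ker F\}$ and $E^{(0,1)}=\{e+i\Phi(e): e\in\ker\eta\oplus\ker F\}$ are the $+i$- and $-i$-eigenbundles of $\Phi$; $L=L_F\oplus E^{(1,0)}$, $\overline L=L_F\oplus E^{(0,1)}$, $L^*=L_\eta\oplus E^{(0,1)}$, $\overline L^*=L_\eta\oplus E^{(1,0)}$. $L^*$ is identified with the dual of $L$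 through $\langle\cdot,\cdot\rangle$. A Dirac structure is a maximally isotropic subbundle (with respect to $\langle\cdot,\cdot\rangle$) of $(TM\oplus T^*M)_{\mathbb C}$ whose space of sections is closed under the Courant bracket. For $(L,L^* )$ to be a Lie bialgebroid (with the restricted Courant bracket and anchor), both $L$ and $L^*$ must be Lie algebroids, so both spaces of sections must be closed under the Courant bracket, and in addition $d_{L^*}[\![a_1,a_2]\!]=[\![d_{L^*}a_1,a_2]\!]+[\![a_1,d_{L^*}a_2]\!]$ for $a_1,a_2\in\Gamma(L)$, where $d_{L^*}$ is the Lie algebroid differential of $L^*$ acting on $\Gamma(\wedge^\bullet L)$.
   Formalization: We assume n ≥ 1 and M nonempty: for n = 0 (e.g. M = R, η = dt) L* is the complexified cotangent bundle, which is Dirac, and (L, L* ) is a Lie bialgebroid; on the empty manifold every bundle is trivially Dirac. *)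

(* Defs.v *)
From mathcomp Require Import all_boot all_order all_algebra all_fingroup.
From mathcomp Require Import all_classical all_reals all_analysis.
From mathcomp Require Import complex.

Set Implicit Arguments.
Unset Strict Implicit.
Unset Printing Implicit Defensive.

Import Order.TTheory GRing.Theory Num.Theory numFieldNormedType.Exports.

Local Open Scope classical_set_scope.
Local Open Scope ring_scope.

Section Calculus.
Context {R : realType} {m : nat}.
Implicit Types (U : set 'rV[R]_m) (f : 'rV[R]_m -> R^o).

Fixpoint C_k (k : nat) U f : Prop :=
  (forall x, U x -> {for x, continuous f}) /\
  (if k is k'.+1 then
     forall i : 'I_m,
       (forall x, U x -> derivable f x (delta_mx 0 i)) /\
       C_k k' U (fun x => 'D_(delta_mx 0 i) f x)
   else True).

Definition smooth_on U f := forall k, C_k k U f.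

End Calculus.

Record chart (R : realType) (m : nat) (T : topologicalType) := Chart {
  chart_dom : set T;
  chart_map : T -> 'rV[R]_m;
  chart_inv : 'rV[R]_m -> T;
  chart_dom_open : open chart_dom;
  chart_cod_open : open (chart_map @` chart_dom);
  chart_mapK : {in chart_dom, cancel chart_map chart_inv};
  chart_map_cts : {within chart_dom, continuous chart_map};
  chart_inv_cts : {within chart_map @` chart_dom, continuous chart_inv} }.

Record smooth_manifold (R : realType) (m : nat) := SmoothManifold {
  mcarrier :> topologicalType;
  atlas : set (chart R m mcarrier);
  manifold_hausdorff : hausdorff_space mcarrier;
  manifold_second_countable : @second_countable mcarrier;
  atlas_cover : forall p : mcarrier, exists2 a, atlas a & chart_dom a p;
  atlas_smooth : forall a b, atlas a -> atlas b -> forall j : 'I_m,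
    smooth_on (chart_map a @` (chart_dom a `&` chart_dom b))
              (fun x => chart_map b (chart_inv a x) 0 j) }.

Section Geometry.
Context {R : realType} {m : nat} {M : smooth_manifold R m}.

Definition smooth (f : M -> R^o) : Prop :=
  forall a, @atlas _ _ M a ->
    smooth_on (chart_map a @` chart_dom a) (f \o chart_inv a).

(* The types [tvec] and [covec] are larger than any T_pM or T*_pM and do not
   depend on p; the predicates [tangent p] and [cotangent p] cut these spaces
   out.  Elements are required to vanish outside their proper domain (the smooth
   functions, resp. T_pM), so that equality in [tvec] and [covec] is equality of
   vectors and covectors. *)
Definition tvec : Type := (M -> R^o) -> R^o.
Definition covec : Type := tvec -> R^o.

(* Derivations of the algebra of smooth functions; X p f is (X f)(p). *)
Definition vector_field (X : M -> tvec) : Prop :=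
  [/\ forall f, smooth f -> smooth (fun p => X p f),
      forall p (c : R) f g, smooth f -> smooth g ->
        X p (c *: f + g) = c * X p f + X p g,
      forall p f g, smooth f -> smooth g ->
        X p (fun q => f q * g q) = X p f * g p + f p * X p g
    & forall p f, ~ smooth f -> X p f = 0].

(* T_pM.  Every derivation of the smooth functions at p is the value at p of a
   vector field on M: extend it near p with constant coefficients in a chart and
   multiply by a cutoff function. *)
Definition tangent (p : M) : set tvec :=
  [set u | exists2 X, vector_field X & X p = u].

(* T*_pM, the linear forms on T_pM. *)
Definition cotangent (p : M) : set covec :=
  [set a | (forall (c : R) u v, tangent p u -> tangent p v ->
              a (c *: u + v) = c * a u + a v) /\
           (forall u, ~ tangent p u -> a u = 0)].

Definition one_form (al : M -> covec) : Prop :=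
  (forall p, cotangent p (al p)) /\
  (forall X, vector_field X -> smooth (fun p => al p (X p))).

(* [om p u v] is om_p(u, v), so that [om p u] is the covector om^flat(u). *)
Definition two_form (om : M -> tvec -> covec) : Prop :=
  [/\ forall p u, tangent p u -> cotangent p (om p u),
      forall p u v, tangent p u -> tangent p v -> om p u v = - om p v u
    & forall X, vector_field X -> one_form (fun p => om p (X p))].

(* A bivector field is given by the map a |-> pi^sharp(a). *)
Definition bivector_field (sh : M -> covec -> tvec) : Prop :=
  [/\ forall p a, cotangent p a -> tangent p (sh p a),
      forall p (c : R) a b, cotangent p a -> cotangent p b ->
        sh p (c *: a + b) = c *: sh p a + sh p b,
      forall p a b, cotangent p a -> cotangent p b -> b (sh p a) = - a (sh p b)
    & forall al, one_form al -> vector_field (fun p => sh p (al p))].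

Definition bivector_eval (sh : M -> covec -> tvec) (p : M) (a b : covec) : R :=
  b (sh p a).

Definition tensor11 (ph : M -> tvec -> tvec) : Prop :=
  [/\ forall p (c : R) u v, tangent p u -> tangent p v ->
        ph p (c *: u + v) = c *: ph p u + ph p v,
      forall X, vector_field X -> vector_field (fun p => ph p (X p))
    & forall p u, ~ tangent p u -> ph p u = 0].

Definition lie_bracket (X Y : M -> tvec) : M -> tvec :=
  fun p f => X p (fun q => Y q f) - Y p (fun q => X q f).

Definition exterior_derivative (al : M -> covec) (om : M -> tvec -> covec) :=
  two_form om /\
  forall X Y, vector_field X -> vector_field Y -> forall p,
    om p (X p) (Y p) = X p (fun q => al q (Y q)) - Y p (fun q => al q (X q))
                       - al p (lie_bracket X Y p).

Definition multiform (k : nat) : Type := ('I_k -> tvec) -> R.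

Definition wedge k l (w : multiform k) (z : multiform l) : multiform (k + l) :=
  fun v => ((k`! * l`!)%:R)^-1 *
    \sum_(s : {perm 'I_(k + l)}) (-1) ^+ s *
      (w (fun i => v (s (lshift l i))) * z (fun j => v (s (rshift k j)))).

Fixpoint wedge_exp (w : multiform 2) (n : nat) : multiform (n * 2) :=
  if n is n'.+1 then wedge w (@wedge_exp w n') else fun=> 1.
Arguments wedge_exp : clear implicits.

Definition multiform1 (a : covec) : multiform 1 := fun v => a (v 0).
Definition multiform2 (w : tvec -> covec) : multiform 2 :=
  fun v => w (v 0) (v 1).

Definition contact_form (n : nat) (eta : M -> covec) : Prop :=
  one_form eta /\
  exists2 deta, exterior_derivative eta deta &
    forall p, exists2 v : 'I_(1 + n * 2) -> tvec, (forall i, tangent p (v i)) &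
      wedge (multiform1 (eta p)) (wedge_exp (multiform2 (deta p)) n) v != 0.

Definition gvec : Type := (tvec * covec)%type.

Definition gfiber (p : M) : set gvec :=
  [set x | tangent p x.1 /\ cotangent p x.2].

Definition gsection (s : M -> gvec) : Prop :=
  vector_field (fun p => (s p).1) /\ one_form (fun p => (s p).2).

Definition pairing (x y : gvec) : R := 2^-1 * (y.2 x.1 + x.2 y.1).

(* The complexification of a real vector space V is V * V, with (a, b) standing
   for a + i b. *)
Definition cbilinear_ext (U : Type) (W : zmodType) (B : U -> U -> W)
    (z w : U * U) : W * W :=
  (B z.1 w.1 - B z.2 w.2, B z.1 w.2 + B z.2 w.1).

Definition complex_scale (V : lmodType R) (c : R[i]) (z : V * V) : V * V :=
  (complex.Re c *: z.1 - complex.Im c *: z.2,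
   complex.Re c *: z.2 + complex.Im c *: z.1).

Definition cgvec : Type := (gvec * gvec)%type.

Definition csec : Type := ((M -> gvec) * (M -> gvec))%type.

Definition cvalue (s : csec) (p : M) : cgvec := (s.1 p, s.2 p).

Definition cgfiber (p : M) : set cgvec :=
  [set z | gfiber p z.1 /\ gfiber p z.2].

Definition cgsection (s : csec) : Prop := gsection s.1 /\ gsection s.2.

Definition cpairing (z w : cgvec) : R[i] :=
  let q := cbilinear_ext (pairing : gvec -> gvec -> R) z w in
  Complex q.1 q.2.

Definition complex_scale_sec (f : M -> R[i]) (s : csec) : csec :=
  (fun p => (complex_scale (f p) (cvalue s p)).1,
   fun p => (complex_scale (f p) (cvalue s p)).2).

Definition csmooth (f : M -> R[i]) : Prop :=
  smooth (fun p => complex.Re (f p)) /\ smooth (fun p => complex.Im (f p)).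

(* rho(z) f, the anchor composed with the complex-linear action on functions *)
Definition anchor_der (z : cgvec) (f : M -> R[i]) : R[i] :=
  let q := (z.1.1 (fun p => complex.Re (f p)) -
              z.2.1 (fun p => complex.Im (f p)),
            z.1.1 (fun p => complex.Im (f p)) +
              z.2.1 (fun p => complex.Re (f p))) in
  Complex q.1 q.2.

(* (L_X be)(Z) *)
Definition lie_form (X : M -> tvec) (be : M -> covec) (Z : M -> tvec) (p : M)
    : R^o :=
  X p (fun q => be q (Z q)) - be p (lie_bracket X Z p).

(* The form part is described through its values on vector fields Z; here
   d(i_X be - i_Y al)(Z) = Z(be(X) - al(Y)). *)
Definition bracket_data : Type :=
  ((M -> tvec) * ((M -> tvec) -> M -> R^o))%type.

Definition courant_data (s t : M -> gvec) : bracket_data :=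
  let X p := (s p).1 in let al p := (s p).2 in
  let Y p := (t p).1 in let be p := (t p).2 in
  (lie_bracket X Y,
   fun Z p => lie_form X be Z p - lie_form Y al Z p
              - 2^-1 * Z p (fun q => be q (X q) - al q (Y q))).

Definition represents (r : M -> gvec) (d : bracket_data) : Prop :=
  (forall p, (r p).1 = d.1 p) /\
  (forall Z, vector_field Z -> forall p, (r p).2 (Z p) = d.2 Z p).

Definition is_courant (s t r : csec) : Prop :=
  let d := cbilinear_ext courant_data s t in
  [/\ cgsection r, represents r.1 d.1 & represents r.2 d.2].

(* [is_courant s t] holds of exactly one section when s and t are sections:
   uniqueness because vector fields fill T_pM, existence because the form part
   of [courant_data] is linear over the smooth functions in Z. *)
Definition courant (s t : csec) : csec := xget 0 (is_courant s t).

Definition cfamily : Type := M -> set cgvec.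

Definition csubspace (p : M) (W : set cgvec) : Prop :=
  [/\ W `<=` cgfiber p, W 0
    & forall (c : R[i]) z w, W z -> W w -> W (complex_scale c z + w)].

Definition Gamma (B : cfamily) : set csec :=
  [set s | cgsection s /\ forall p, B p (cvalue s p)].

(* A family of subspaces spanned by its sections.  It is a vector subbundle in
   the usual sense as soon as its rank is constant.  This is automatic for the
   maximally isotropic families below: the pairing is nondegenerate on fibres
   of complex dimension 2m, so all its maximally isotropic subspaces have
   dimension m. *)
Definition subbundle (B : cfamily) : Prop :=
  forall p, csubspace p (B p) /\
    forall z, B p z -> exists2 s, Gamma B s & cvalue s p = z.

Definition isotropic (W : set cgvec) : Prop :=
  forall z w, W z -> W w -> cpairing z w = 0.

Definition maximally_isotropic (p : M) (W : set cgvec) : Prop :=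
  [/\ csubspace p W, isotropic W
    & forall W', csubspace p W' -> isotropic W' -> W `<=` W' -> W' = W].

Definition courant_closed (B : cfamily) : Prop :=
  forall s t, Gamma B s -> Gamma B t -> Gamma B (courant s t).

Definition dirac_structure (B : cfamily) : Prop :=
  [/\ subbundle B, forall p, maximally_isotropic p (B p) & courant_closed B].

Definition lie_algebroid (B : cfamily) : Prop :=
  [/\ courant_closed B,
      forall s t, Gamma B s -> Gamma B t -> courant s t = - courant t s,
      forall s t u, Gamma B s -> Gamma B t -> Gamma B u ->
        courant (courant s t) u + courant (courant t u) s
        + courant (courant u s) t = 0
    & forall s t f, Gamma B s -> Gamma B t -> csmooth f ->
        courant s (complex_scale_sec f t) =
        complex_scale_sec f (courant s t)
        + complex_scale_sec (fun p => anchor_der (cvalue s p) f) t].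

Definition sec_pairing (s t : csec) (p : M) : R[i] :=
  cpairing (cvalue s p) (cvalue t p).

(* Sections of wedge^2 A as bilinear maps on the sections of As, where As is
   identified with the dual of A by the pairing. *)
Definition biform : Type := csec -> csec -> M -> R[i].

(* d_{As} a, for a in Gamma(A) *)
Definition dual_differential (a : csec) : biform := fun x y p =>
  anchor_der (cvalue x p) (sec_pairing a y)
  - anchor_der (cvalue y p) (sec_pairing a x)
  - sec_pairing a (courant x y) p.

(* L_a x, for a in Gamma(A) and x in Gamma(As) *)
Definition dual_lie_derivative (A As : cfamily) (a x : csec) : csec :=
  xget 0 [set y | Gamma As y /\ forall b, Gamma A b -> forall p,
    sec_pairing y b p = anchor_der (cvalue a p) (sec_pairing x b)
                        - sec_pairing x (courant a b) p].

(* The Schouten bracket [a, P] = L_a P of a in Gamma(A) and P in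
   Gamma(wedge^2 A); in this degree [P, a] = - [a, P]. *)
Definition schouten_l (A As : cfamily) (a : csec) (P : biform) : biform :=
  fun x y p => anchor_der (cvalue a p) (P x y)
    - P (dual_lie_derivative A As a x) y p
    - P x (dual_lie_derivative A As a y) p.

Definition schouten_r (A As : cfamily) (P : biform) (a : csec) : biform :=
  fun x y p => - schouten_l A As a P x y p.

Definition lie_bialgebroid (A As : cfamily) : Prop :=
  [/\ lie_algebroid A, lie_algebroid As
    & forall a1 a2, Gamma A a1 -> Gamma A a2 ->
      forall x y, Gamma As x -> Gamma As y -> forall p,
        dual_differential (courant a1 a2) x y p =
        schouten_r A As (dual_differential a1) a2 x y p
        + schouten_l A As a1 (dual_differential a2) x y p].

Record contact_tensors := ContactTensors {
  ct_F : M -> tvec;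
  ct_eta : M -> covec;
  ct_pi : M -> covec -> tvec;
  ct_theta : M -> tvec -> covec;
  ct_phi : M -> tvec -> tvec }.

Definition tensorial (J : contact_tensors) : Prop :=
  [/\ vector_field (ct_F J), one_form (ct_eta J), bivector_field (ct_pi J),
      two_form (ct_theta J) & tensor11 (ct_phi J)].

Definition Phi (J : contact_tensors) (p : M) (x : gvec) : gvec :=
  (ct_phi J p x.1 + ct_pi J p x.2,
   ct_theta J p x.1 - (fun u => x.2 (ct_phi J p u))).

Definition generalized_almost_contact (J : contact_tensors) : Prop :=
  tensorial J /\ forall p,
  [/\ forall x y, gfiber p x -> gfiber p y ->
        pairing (Phi J p x) y + pairing x (Phi J p y) = 0,
      ct_eta J p (ct_F J p) = 1,
      Phi J p (ct_F J p, 0) = 0,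
      Phi J p (0, ct_eta J p) = 0
    & forall x, gfiber p x ->
        Phi J p (Phi J p x) =
        - x + (ct_eta J p x.1 *: ct_F J p, x.2 (ct_F J p) *: ct_eta J p)].

Definition flat (J : contact_tensors) (p : M) (u : tvec) : covec :=
  ct_theta J p u - ct_eta J p u *: ct_eta J p.

Definition flat_inv (J : contact_tensors) (p : M) : covec -> tvec :=
  'pinv_(fun=> 0) (tangent p) (flat J p).

(* On M of dimension 2n + 1, [flat J p] is a bijection from T_pM
   onto T*_pM for a contact form, and [flat_inv J p] is its inverse. *)
Definition associated_to_contact_form (n : nat) (J : contact_tensors) : Prop :=
  [/\ contact_form n (ct_eta J),
      exterior_derivative (ct_eta J) (ct_theta J),
      forall p, ct_eta J p (ct_F J p) = 1 /\ ct_theta J p (ct_F J p) = 0,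
      forall p a b, cotangent p a -> cotangent p b ->
        bivector_eval (ct_pi J) p a b =
        ct_theta J p (flat_inv J p a) (flat_inv J p b)
    & forall p u, ct_phi J p u = 0].

Section Bundles.
Context (J : contact_tensors).

Definition ker_sum (p : M) : set gvec :=
  [set x | [/\ gfiber p x, ct_eta J p x.1 = 0 & x.2 (ct_F J p) = 0]].

Definition cker_sum : cfamily := fun p =>
  [set z | ker_sum p z.1 /\ ker_sum p z.2].

Definition cPhi (p : M) (z : cgvec) : cgvec := (Phi J p z.1, Phi J p z.2).

Definition E10 : cfamily := fun p =>
  [set e - complex_scale 'i%C (cPhi p e) | e in cker_sum p].

Definition E01 : cfamily := fun p =>
  [set e + complex_scale 'i%C (cPhi p e) | e in cker_sum p].

Definition line_F : cfamily := fun p =>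
  [set complex_scale c ((ct_F J p, 0), 0) | c in [set: R[i]]].

Definition line_eta : cfamily := fun p =>
  [set complex_scale c ((0, ct_eta J p), 0) | c in [set: R[i]]].

Definition family_sum (A B : cfamily) : cfamily := fun p =>
  [set z | exists2 x, A p x & exists2 y, B p y & z = x + y].

Definition L_bundle : cfamily := family_sum line_F E10.
Definition Lbar_bundle : cfamily := family_sum line_F E01.
Definition Lstar_bundle : cfamily := family_sum line_eta E01.
Definition Lbarstar_bundle : cfamily := family_sum line_eta E10.

End Bundles.

End Geometry.

Arguments contact_tensors {R m} M.

(* Main.v *)
Require Import Defs.
From mathcomp Require Import all_boot all_order all_algebra.
From mathcomp Require Import all_classical all_reals all_analysis.
From mathcomp Require Import complex ring lra.

Set Implicit Arguments.
Unset Strict Implicit.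
Unset Printing Implicit Defensive.

Import Order.TTheory GRing.Theory Num.Theory numFieldNormedType.Exports.

(** Write theta = d eta.  On ker F the map - pi^sharp inverts theta^flat, so an
    element e -+ i Phi(e) of E^(1,0) or E^(0,1) has the form U -+ i theta(U) for
    a complex tangent vector U in ker eta.  Since theta(F) = 0, adding the line
    spanned by F removes the condition U in ker eta: L and its conjugate are the
    graphs of - i theta and of + i theta over the whole complexified tangent
    bundle ([L_bundleE], [Lbar_bundleE]).

    The graph of an imaginary 2-form is maximally isotropic because it equals
    its own orthogonal.  When the form is closed, U |-> U + i c theta(U) carries
    the Lie bracket to the Courant bracket ([courant_graph_section]); this comes
    down to
      L_X (i_Y theta) - L_Y (i_X theta) + d (theta(X, Y)) = i_[X, Y] theta,
    which is d theta = 0.  So graphs of closed imaginary 2-forms are Dirac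
    structures ([graph_dirac]).  The same formula shows that the Courant bracket
    of two such sections exists as a section, without any appeal to the
    pointwise nature of forms that are linear over the smooth functions.

    The vector part of L* and of its conjugate lies in ker eta, and for X a
    real field in ker eta they contain the section X + i theta(X), respectively
    X - i theta(X).  The bracket of two such sections over X and Y has vector
    part [X, Y], and eta([X, Y]) = - theta(X, Y).  As
    theta has the kernel vector F and eta /\ theta^n <> 0 with n > 0, theta is
    nonzero on ker eta, hence the sections are not closed under the bracket
    ([line_eta_not_courant_closed]).  This rules out both a Dirac structure and
    a Lie bialgebroid. *)

(** * Smooth functions *)

Section SmoothFunctions.
Local Open Scope classical_set_scope.
Local Open Scope ring_scope.
Context {R : realType} {m : nat}.
Implicit Types (U : set 'rV[R]_m) (f g : 'rV[R]_m -> R^o).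

(** The class C^k on an open set only depends on the values there. *)
Lemma C_k_eq k U f g : open U -> {in U, f =1 g} -> C_k k U f -> C_k k U g.
Proof.
elim: k f g => [|k IHk] f g oU fg [cf df].
all: have nfg x (Ux : U x) : {near x, f =1 g}
  by near=> y; apply: fg; apply/mem_set; near: y; exact: open_nbhs_nbhs.
all: have cg x (Ux : U x) : {for x, continuous g}.
1,3: rewrite /prop_for /continuous_at -(fg x (mem_set Ux));
  exact: cvg_trans (near_eq_cvg (nfg x Ux)) (cf x Ux).
  by [].
split=> // i; have [dfi Cdfi] := df i; split.
  by move=> x Ux; apply: near_eq_derivable (dfi x Ux); exact: nfg.
apply: IHk Cdfi => // x /set_mem Ux; apply: near_eq_derive; exact: nfg.
Unshelve. all: by end_near. Qed.

Lemma C_kW k U f : C_k k.+1 U f -> C_k k U f.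
Proof.
elim: k f => [|k IHk] f [cf df]; split=> // i.
by have [dfi Cdfi] := df i; split=> //; exact: IHk.
Qed.

Lemma C_k_cst k U c : C_k k U (cst c).
Proof.
have cc c' x : {for x, continuous (cst c' : 'rV[R]_m -> R^o)}.
  by exact: cst_continuous.
elim: k c => [|k IHk] c; split=> //; try by move=> x _; exact: cc.
move=> i; split=> [x _|]; first exact: (derivable_cst (c : R^o)).
have -> : (fun x => 'D_(delta_mx 0 i) (cst c : 'rV[R]_m -> R^o) x) = cst 0.
  by apply/funext => x; rewrite derive_cst.
exact: IHk.
Qed.

Lemma C_k_linear k U c f g :
  open U -> C_k k U f -> C_k k U g -> C_k k U (c *: f + g).
Proof.
move=> oU; elim: k f g => [|k IHk] f g [cf df] [cg dg].
all: split.
1,3: move=> x Ux; exact: (cvgD (cvgM (cvg_cst c) (cf x Ux)) (cg x Ux)).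
  by [].
move=> i; have [[dfi Cdfi] [dgi Cdgi]] := (df i, dg i); split.
  move=> x Ux; apply: derivableD; [apply: derivableZ; exact: dfi|exact: dgi].
apply: C_k_eq (IHk _ _ Cdfi Cdgi) => // x /set_mem Ux.
rewrite deriveD; [|apply: derivableZ; exact: dfi|exact: dgi].
by rewrite deriveZ//; exact: dfi.
Qed.

Lemma C_k_mul k U f g :
  open U -> C_k k U f -> C_k k U g -> C_k k U (fun x => f x * g x).
Proof.
move=> oU; elim: k f g => [|k IHk] f g Cf Cg.
all: have [[cf df] [cg dg]] := (Cf, Cg); split.
1,3: move=> x Ux; exact: (cvgM (cf x Ux) (cg x Ux)).
  by [].
move=> i; have [[dfi Cdfi] [dgi Cdgi]] := (df i, dg i); split.
  move=> x Ux; apply: derivableM; [exact: dfi|exact: dgi].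
have := C_k_linear 1 oU (IHk _ _ (C_kW Cf) Cdgi) (IHk _ _ (C_kW Cg) Cdfi).
apply: C_k_eq => // x /set_mem Ux.
rewrite [RHS]deriveM; [|exact: dfi|exact: dgi].
by rewrite scale1r.
Qed.

Context {M : smooth_manifold R m}.
Implicit Types (u v : M -> R^o).

Lemma smooth_cst c : @smooth _ _ M (cst c).
Proof. by move=> a _ k; exact: C_k_cst. Qed.

Lemma smooth_linear c u v : smooth u -> smooth v -> smooth (c *: u + v).
Proof.
move=> su sv a Aa k.
exact: C_k_linear (@chart_cod_open _ _ _ a) (su a Aa k) (sv a Aa k).
Qed.

Lemma smoothM u v : smooth u -> smooth v -> smooth (fun q => u q * v q).
Proof.
move=> su sv a Aa k.
exact: C_k_mul (@chart_cod_open _ _ _ a) (su a Aa k) (sv a Aa k).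
Qed.

Lemma smoothD u v : smooth u -> smooth v -> smooth (fun q => u q + v q).
Proof.
move=> su sv; have := smooth_linear 1 su sv.
by congr smooth; apply/funext => q; rewrite /= scale1r.
Qed.

Lemma smoothN u : smooth u -> smooth (fun q => - u q).
Proof.
move=> su; have := smoothM (smooth_cst (-1)) su.
by congr smooth; apply/funext => q; rewrite mulN1r.
Qed.

Lemma smoothB u v : smooth u -> smooth v -> smooth (fun q => u q - v q).
Proof. by move=> su sv; exact: (smoothD su (smoothN sv)). Qed.

End SmoothFunctions.

(** * Vector fields and covectors *)

Section VectorFields.
Local Open Scope classical_set_scope.
Local Open Scope ring_scope.
Context {R : realType} {m : nat} {M : smooth_manifold R m}.
Implicit Types (f g : M -> R^o) (X Y Z : M -> tvec (M := M)).

Lemma tvec_addE (u v : tvec (M := M)) f : (u + v) f = u f + v f.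
Proof. by []. Qed.

Lemma tvec_scaleE c (u : tvec (M := M)) f : (c *: u) f = c * u f.
Proof. by []. Qed.

Lemma covec_addE (a b : covec (M := M)) u : (a + b) u = a u + b u.
Proof. by []. Qed.

Lemma covec_scaleE c (a : covec (M := M)) u : (c *: a) u = c * a u.
Proof. by []. Qed.

Lemma covec_oppE (a : covec (M := M)) u : (- a) u = - a u.
Proof. by []. Qed.

Lemma vfieldZD X p c f g : vector_field X -> smooth f -> smooth g ->
  X p (fun q => c * f q + g q) = c * X p f + X p g.
Proof. by case=> _ + _ _; exact. Qed.

Lemma vfield0 X p : vector_field X -> X p (cst 0) = 0.
Proof.
move=> vX; have := vfieldZD p (-1) vX (smooth_cst 0) (smooth_cst 0).
rewrite mulN1r addNr => h; rewrite -[RHS]h; congr (X p).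
by apply/funext => q; rewrite /cst mulr0 addr0.
Qed.

Lemma vfieldD X p f g : vector_field X -> smooth f -> smooth g ->
  X p (fun q => f q + g q) = X p f + X p g.
Proof.
move=> vX sf sg; have := vfieldZD p 1 vX sf sg; rewrite mul1r => <-.
by congr (X p); apply/funext => q; rewrite mul1r.
Qed.

Lemma vfieldZ X p c f : vector_field X -> smooth f ->
  X p (fun q => c * f q) = c * X p f.
Proof.
move=> vX sf; have := vfieldZD p c vX sf (smooth_cst 0).
by rewrite vfield0// addr0 => <-; congr (X p); apply/funext => q; rewrite addr0.
Qed.

Lemma vfieldN X p f : vector_field X -> smooth f ->
  X p (fun q => - f q) = - X p f.
Proof.
move=> vX sf; rewrite -mulN1r -vfieldZ//.
by congr (X p); apply/funext => q; rewrite mulN1r.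
Qed.

Lemma vfieldB X p f g : vector_field X -> smooth f -> smooth g ->
  X p (fun q => f q - g q) = X p f - X p g.
Proof.
by move=> vX sf sg; rewrite -vfieldN// -vfieldD//; exact: smoothN.
Qed.

Lemma vector_field0 : vector_field (fun _ : M => 0).
Proof.
split=> [f _|p c f g _ _|p f g _ _|//]; first exact: smooth_cst.
- by rewrite /= mulr0 addr0.
- by rewrite /= mul0r mulr0 addr0.
Qed.

Lemma vector_fieldD X Y : vector_field X -> vector_field Y ->
  vector_field (fun p => X p + Y p).
Proof.
move=> [X1 X2 X3 X4] [Y1 Y2 Y3 Y4].
split=> [f sf|p c f g sf sg|p f g sf sg|p f nf].
- by apply: smoothD; [exact: X1|exact: Y1].
- by rewrite !tvec_addE X2// Y2//; ring.
- by rewrite !tvec_addE X3// Y3//; ring.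
- by rewrite !tvec_addE X4// Y4// addr0.
Qed.

Lemma vector_fieldM f X : smooth f -> vector_field X ->
  vector_field (fun p => f p *: X p).
Proof.
move=> sf [X1 X2 X3 X4]; split=> [g sg|p c g h sg sh|p g h sg sh|p g ng].
- by apply: smoothM => //; exact: X1.
- by rewrite !tvec_scaleE X2//; ring.
- by rewrite !tvec_scaleE X3//; ring.
- by rewrite !tvec_scaleE X4// mulr0.
Qed.

Lemma vector_fieldB X Y : vector_field X -> vector_field Y ->
  vector_field (fun p => X p - Y p).
Proof.
move=> vX vY; have := vector_fieldD vX (vector_fieldM (smooth_cst (-1)) vY).
by congr vector_field; apply/funext => p; rewrite scaleN1r.
Qed.

Lemma vector_field_bracket X Y : vector_field X -> vector_field Y ->
  vector_field (lie_bracket X Y).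
Proof.
move=> vX vY; have [X1 X2 X3 X4] := vX; have [Y1 Y2 Y3 Y4] := vY.
split=> [f sf|p c f g sf sg|p f g sf sg|p f nf]; rewrite /lie_bracket.
- by apply: smoothB; [exact/X1/Y1|exact/Y1/X1].
- have -> : (fun q => Y q (c *: f + g)) = (fun q => c * Y q f + Y q g).
    by apply/funext => q; exact: Y2.
  have -> : (fun q => X q (c *: f + g)) = (fun q => c * X q f + X q g).
    by apply/funext => q; exact: X2.
  by rewrite !vfieldZD//; first ring; auto.
- have -> : (fun q => Y q (fun r => f r * g r)) =
            (fun q => Y q f * g q + f q * Y q g).
    by apply/funext => q; exact: Y3.
  have -> : (fun q => X q (fun r => f r * g r)) =
            (fun q => X q f * g q + f q * X q g).
    by apply/funext => q; exact: X3.
  rewrite !vfieldD//; try by apply: smoothM => //; auto.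
  by rewrite !X3 ?Y3//; auto; ring.
- have -> : (fun q => Y q f) = cst 0 by apply/funext => q; exact: Y4.
  have -> : (fun q => X q f) = cst 0 by apply/funext => q; exact: X4.
  by rewrite !vfield0// subrr.
Qed.

Lemma tangent0 (p : M) : tangent p 0.
Proof. by exists (fun=> 0) => //; exact: vector_field0. Qed.

Lemma tangentD (p : M) u v : tangent p u -> tangent p v -> tangent p (u + v).
Proof.
by move=> [X vX <-] [Y vY <-]; exists (fun q => X q + Y q) => //;
  exact: vector_fieldD.
Qed.

Lemma tangentZ (p : M) c u : tangent p u -> tangent p (c *: u).
Proof.
move=> [X vX <-]; exists (fun q => c *: X q) => //.
exact: (vector_fieldM (smooth_cst c)).
Qed.

Lemma tangentN (p : M) u : tangent p u -> tangent p (- u).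
Proof. by rewrite -scaleN1r; exact: tangentZ. Qed.

Lemma tangentB (p : M) u v : tangent p u -> tangent p v -> tangent p (u - v).
Proof. by move=> tu tv; apply: tangentD => //; exact: tangentN. Qed.

Section Covectors.
Context (p : M) (a : covec (M := M)) (ca : cotangent p a).

Lemma covec0 : a 0 = 0.
Proof.
have := ca.1 (-1) _ _ (tangent0 p) (tangent0 p).
by rewrite scaler0 addr0 mulN1r addNr.
Qed.

Lemma covecD u v : tangent p u -> tangent p v -> a (u + v) = a u + a v.
Proof. by move=> tu tv; have := ca.1 1 _ _ tu tv; rewrite scale1r mul1r. Qed.

Lemma covecZ c u : tangent p u -> a (c *: u) = c * a u.
Proof.
by move=> tu; have := ca.1 c _ _ tu (tangent0 p); rewrite covec0 !addr0.
Qed.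

Lemma covecN u : tangent p u -> a (- u) = - a u.
Proof. by move=> tu; rewrite -scaleN1r covecZ// mulN1r. Qed.

Lemma covecB u v : tangent p u -> tangent p v -> a (u - v) = a u - a v.
Proof. by move=> tu tv; rewrite covecD ?covecN//; exact: tangentN. Qed.

Lemma cotangentZ c : cotangent p (c *: a).
Proof.
split=> [d u v tu tv|u ntu]; last by rewrite covec_scaleE ca.2// mulr0.
by rewrite !covec_scaleE ca.1//; ring.
Qed.

End Covectors.

Lemma cotangent_eq (p : M) a b : cotangent p a -> cotangent p b ->
  (forall u, tangent p u -> a u = b u) -> a = b.
Proof.
move=> ca cb ab; apply/funext => u.
by have [/ab//|ntu] := pselect (tangent p u); rewrite ca.2// cb.2.
Qed.

Lemma cotangent0 (p : M) : cotangent p (0 : covec).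
Proof. by split=> // c u v _ _; rewrite /= mulr0 addr0. Qed.

Lemma cotangentD (p : M) a b :
  cotangent p a -> cotangent p b -> cotangent p (a + b).
Proof.
move=> ca cb; split=> [c u v tu tv|u ntu]; rewrite !covec_addE.
  by rewrite ca.1// cb.1//; ring.
by rewrite ca.2// cb.2// addr0.
Qed.

Lemma one_formZ c (al : M -> covec) :
  one_form al -> one_form (fun p => c *: al p).
Proof.
move=> [cal sal]; split=> [p|X vX]; first exact: cotangentZ.
by apply: smoothM; [exact: smooth_cst|exact: sal].
Qed.

End VectorFields.

(** * Two-forms and exterior derivatives *)

Section TwoForms.
Local Open Scope classical_set_scope.
Local Open Scope ring_scope.
Context {R : realType} {m : nat} {M : smooth_manifold R m}.
Implicit Types (X Y Z : M -> tvec (M := M)).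
Implicit Types (om : M -> tvec (M := M) -> covec (M := M)).

Section Algebra.
Context om (tf : two_form om).

Lemma two_form_cotangent p u : tangent p u -> cotangent p (om p u).
Proof. by case: tf => + _ _; exact. Qed.

Lemma two_formC p u v : tangent p u -> tangent p v -> om p u v = - om p v u.
Proof. by case: tf => _ + _; exact. Qed.

Lemma two_form_smooth X Y : vector_field X -> vector_field Y ->
  smooth (fun p => om p (X p) (Y p)).
Proof. by move=> vX vY; case: tf => _ _ /(_ X vX)[_]; exact. Qed.

Lemma two_formD p u v : tangent p u -> tangent p v ->
  om p (u + v) = om p u + om p v.
Proof.
move=> tu tv; have tuv := tangentD tu tv.
have [cu cv cuv] := And3 (two_form_cotangent tu) (two_form_cotangent tv)
  (two_form_cotangent tuv).
apply: (cotangent_eq cuv); first exact: cotangentD.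
move=> w tw; have cw := two_form_cotangent tw.
by rewrite covec_addE !(two_formC _ tw)// (covecD cw)// opprD.
Qed.

Lemma two_formZ p c u : tangent p u -> om p (c *: u) = c *: om p u.
Proof.
move=> tu; have tcu := tangentZ c tu.
apply: (cotangent_eq (two_form_cotangent tcu)).
  exact/cotangentZ/two_form_cotangent.
move=> w tw; have cw := two_form_cotangent tw.
by rewrite covec_scaleE !(two_formC _ tw)// (covecZ cw)// mulrN.
Qed.

Lemma two_form0 p : om p 0 = 0.
Proof. by rewrite -(scale0r 0) two_formZ ?scale0r//; exact: tangent0. Qed.

Lemma two_formN p u : tangent p u -> om p (- u) = - om p u.
Proof. by move=> tu; rewrite -scaleN1r two_formZ// scaleN1r. Qed.

Lemma two_formB p u v : tangent p u -> tangent p v ->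
  om p (u - v) = om p u - om p v.
Proof. by move=> tu tv; rewrite two_formD ?two_formN//; exact: tangentN. Qed.

End Algebra.

(** Closedness of a 2-form, d om = 0, through the invariant formula for the
    exterior derivative. *)
Definition closed_two_form om :=
  forall X Y Z, vector_field X -> vector_field Y -> vector_field Z -> forall p,
    X p (fun q => om q (Y q) (Z q)) + Y p (fun q => om q (Z q) (X q))
    + Z p (fun q => om q (X q) (Y q))
    - om p (lie_bracket X Y p) (Z p) - om p (lie_bracket Y Z p) (X p)
    - om p (lie_bracket Z X p) (Y p) = 0.

(** d (d al) = 0: the second derivatives cancel in pairs, and the terms
    al([[X, Y], Z]) cancel by the Jacobi identity. *)
Lemma exterior_derivative_closed al om :
  one_form al -> exterior_derivative al om -> closed_two_form om.
Proof.
move=> [cal sal] [tf dal] X Y Z vX vY vZ p.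
have s1 U V : vector_field U -> vector_field V ->
  smooth (fun q => U q (fun r => al r (V r))).
  by move=> vU vV; case: (vU) => + _ _ _; apply; exact: sal.
have E U V W : vector_field U -> vector_field V -> vector_field W ->
    W p (fun q => om q (U q) (V q)) =
    W p (fun q => U q (fun r => al r (V r)))
    - W p (fun q => V q (fun r => al r (U r)))
    - W p (fun q => al q (lie_bracket U V q)).
  move=> vU vV vW.
  rewrite -vfieldB//; [|exact: s1..].
  rewrite -vfieldB//;
    [|by apply: smoothB; exact: s1|exact/sal/vector_field_bracket].
  by congr (W p); apply/funext => q; rewrite dal.
rewrite !E// !dal//; try exact: vector_field_bracket.
have J : lie_bracket (lie_bracket X Y) Z p + lie_bracket (lie_bracket Y Z) X p
       + lie_bracket (lie_bracket Z X) Y p = 0.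
  apply/funext => f; rewrite !tvec_addE.
  have [sf|nf] := pselect (smooth f); last first.
    have z U : vector_field U -> U p f = 0 by case=> _ _ _; exact.
    have zb U V W : vector_field U -> vector_field V -> vector_field W ->
        lie_bracket (lie_bracket U V) W p f = 0.
      move=> vU vV vW.
      exact: z (vector_field_bracket (vector_field_bracket vU vV) vW).
    by rewrite !zb// !addr0.
  rewrite /lie_bracket.
  have sv U : vector_field U -> smooth (fun q => U q f).
    by case=> + _ _ _; exact.
  have svv U V : vector_field U -> vector_field V ->
      smooth (fun q => U q (fun r => V r f)).
    by move=> vU vV; case: (vU) => + _ _ _; apply; exact: sv.
  (* The zero tangent vector evaluates to the real number 0. *)
  apply: (@etrans _ _ (0 : R)); last by [].
  have [sXY sYZ sZX] := And3 (svv _ _ vX vY) (svv _ _ vY vZ) (svv _ _ vZ vX).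
  have [sYX sZY sXZ] := And3 (svv _ _ vY vX) (svv _ _ vZ vY) (svv _ _ vX vZ).
  by rewrite !vfieldB//; ring.
have tJ U V W : vector_field U -> vector_field V -> vector_field W ->
    tangent p (lie_bracket (lie_bracket U V) W p).
  move=> vU vV vW; exists (lie_bracket (lie_bracket U V) W) => //.
  exact: vector_field_bracket (vector_field_bracket vU vV) vW.
have [tXYZ tYZX tZXY] :=
  And3 (tJ _ _ _ vX vY vZ) (tJ _ _ _ vY vZ vX) (tJ _ _ _ vZ vX vY).
have := covec0 (cal p); rewrite -{1}J (covecD (cal p))//; last exact: tangentD.
rewrite (covecD (cal p))// => aJ.
have bE U V f : lie_bracket U V p f =
    U p (fun q => V q f) - V p (fun q => U q f) by [].
by rewrite !bE -[RHS]aJ; ring.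
Qed.

End TwoForms.

(** * Graphs of closed imaginary two-forms *)

Section Graphs.
Local Open Scope classical_set_scope.
Local Open Scope ring_scope.
Context {R : realType} {m : nat} {M : smooth_manifold R m}.
Implicit Types (X Y Z : M -> tvec (M := M)).

(** A section is determined by its values on vector fields, because vector
    fields fill the tangent spaces and covectors vanish off them. *)
Lemma is_courant_unique (s t r r' : csec (M := M)) :
  is_courant s t r -> is_courant s t r' -> r = r'.
Proof.
(* The real and imaginary parts are treated alike. *)
have half (a b : M -> gvec) d : gsection a -> gsection b ->
    represents a d -> represents b d -> a = b.
  move=> [_ [ca _]] [_ [cb _]] [a1 a2] [b1 b2]; apply/funext => p.
  rewrite [a p]surjective_pairing [b p]surjective_pairing a1 b1.
  congr pair; apply: (cotangent_eq (ca p) (cb p)) => u [Z vZ <-].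
  by rewrite a2// b2.
move=> [[sr1 sr2] r1 r2] [[sr1' sr2'] r1' r2'].
rewrite [r]surjective_pairing [r']surjective_pairing.
by rewrite (half _ _ _ sr1 sr1' r1 r1') (half _ _ _ sr2 sr2' r2 r2').
Qed.

(** The Courant bracket, defined by choice, equals every section that satisfies
    its defining equations. *)
Lemma courantE (s t r : csec (M := M)) : is_courant s t r -> courant s t = r.
Proof. by move=> h; apply: xget_unique => // r' /is_courant_unique; exact. Qed.

Context (om : M -> tvec (M := M) -> covec (M := M)) (tf : two_form om).

Lemma vfield_two_formC X Y Z p :
  vector_field X -> vector_field Y -> vector_field Z ->
  Z p (fun q => om q (Y q) (X q)) = - Z p (fun q => om q (X q) (Y q)).
Proof.
move=> vX vY vZ; rewrite -vfieldN//; last exact: two_form_smooth.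
congr (Z p); apply/funext => q; apply: two_formC => //; by [exists Y|exists X].
Qed.

(** The form part of the Courant bracket of X + a i_A om and Y + b i_B om. *)
Lemma courant_data_scaled X A Y B Z a b p :
  vector_field X -> vector_field A -> vector_field Y -> vector_field B ->
  vector_field Z ->
  (courant_data (fun q => (X q, a *: om q (A q)))
                (fun q => (Y q, b *: om q (B q)))).2 Z p =
  b * lie_form X (fun q => om q (B q)) Z p
  - a * lie_form Y (fun q => om q (A q)) Z p
  + 2^-1 * (b * Z p (fun q => om q (X q) (B q))
            + a * Z p (fun q => om q (A q) (Y q))).
Proof.
move=> vX vA vY vB vZ; rewrite /courant_data /lie_form /=.
have sm U V : vector_field U -> vector_field V ->
  smooth (fun q => om q (U q) (V q)) by exact: two_form_smooth.
have sc U V d : vector_field U -> vector_field V ->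
  smooth (fun q => d * om q (U q) (V q)).
  by move=> vU vV; apply: smoothM; [exact: smooth_cst|exact: sm].
have E d U V W : vector_field U -> vector_field V -> vector_field W ->
    U p (fun q => (d *: om q (V q)) (W q)) =
    d * U p (fun q => om q (V q) (W q)).
  by move=> vU vV vW; rewrite -vfieldZ//; exact: sm.
rewrite !E// vfieldB; [|by []|exact: sc..]; rewrite !E// !covec_scaleE.
by rewrite (vfield_two_formC p vX vB vZ); ring.
Qed.

(** The graph {U + i c om(U)} of i c om, with U = X + i Y a complex tangent
    vector: its real part is X - c om(Y) and its imaginary part Y + c om(X). *)
Definition graph_family (c : R) : cfamily (M := M) := fun p =>
  [set z | [/\ tangent p z.1.1, tangent p z.2.1,
               z.1.2 = (- c) *: om p z.2.1 & z.2.2 = c *: om p z.1.1]].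

(** The section of the graph over the complex vector field X + i Y. *)
Definition graph_section (c : R) X Y : csec (M := M) :=
  (fun p => (X p, (- c) *: om p (Y p)), fun p => (Y p, c *: om p (X p))).

Lemma Gamma_graph_section c X Y : vector_field X -> vector_field Y ->
  Gamma (graph_family c) (graph_section c X Y).
Proof.
have fomX d U : vector_field U -> one_form (fun p => d *: om p (U p)).
  by move=> vU; apply: one_formZ; case: tf => _ _; exact.
move=> vX vY; split; first by split; split => //=; exact: fomX.
by move=> p; split => //=; [exists X|exists Y].
Qed.

Lemma Gamma_graphP c s : Gamma (graph_family c) s ->
  exists X Y, [/\ vector_field X, vector_field Y & s = graph_section c X Y].
Proof.
case: s => s1 s2 [[[v1 _] [v2 _]] G].
exists (fun p => (s1 p).1), (fun p => (s2 p).1); split=> //.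
congr pair; apply/funext => p; have [_ _ /= e1 e2] := G p.
  by rewrite -e1 -surjective_pairing.
by rewrite -e2 -surjective_pairing.
Qed.

Lemma graph_csubspace c p : csubspace p (graph_family c p).
Proof.
split.
- move=> [[z11 z12] [z21 z22]] [/= t1 t2 -> ->].
  by split; split=> //=; apply: cotangentZ; exact: two_form_cotangent.
- by split; rewrite ?(two_form0 tf) ?scaler0//; exact: tangent0.
- move=> d [[z11 z12] [z21 z22]] [[w11 w12] [w21 w22]].
  move=> [/= tz1 tz2 -> ->] [/= tw1 tw2 -> ->].
  have tR : tangent p (complex.Re d *: z11 - complex.Im d *: z21).
    by apply: tangentB; exact: tangentZ.
  have tI : tangent p (complex.Re d *: z21 + complex.Im d *: z11).
    by apply: tangentD; exact: tangentZ.
  have omE : om p (complex.Re d *: z11 - complex.Im d *: z21 + w11) =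
      complex.Re d *: om p z11 - complex.Im d *: om p z21 + om p w11.
    rewrite (two_formD tf)// (two_formB tf) ?(two_formZ tf)//; exact: tangentZ.
  have omI : om p (complex.Re d *: z21 + complex.Im d *: z11 + w21) =
      complex.Re d *: om p z21 + complex.Im d *: om p z11 + om p w21.
    rewrite !(two_formD tf) ?(two_formZ tf)//; exact: tangentZ.
  split=> /=; [exact: tangentD|exact: tangentD|rewrite omI|rewrite omE];
    by apply/funext => u; rewrite /complex_scale /=
      !(covec_addE, covec_scaleE, covec_oppE) /=; ring.
Qed.

Lemma graph_subbundle c : subbundle (graph_family c).
Proof.
move=> p; split; first exact: graph_csubspace.
move=> [[z11 z12] [z21 z22]] [/= [X vX <-] [Y vY <-] -> ->].
by exists (graph_section c X Y) => //; exact: Gamma_graph_section.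
Qed.

Lemma graph_isotropic c p : isotropic (graph_family c p).
Proof.
move=> [[z11 z12] [z21 z22]] [[w11 w12] [w21 w22]].
move=> [/= tz1 tz2 -> ->] [/= tw1 tw2 -> ->].
rewrite /cpairing /cbilinear_ext /pairing /= !covec_scaleE.
have C := two_formC tf.
rewrite (C p w21 z11)// (C p w11 z21)// (C p w21 z21)// (C p w11 z11)//.
by congr Complex; ring.
Qed.

(** A vector orthogonal to the vectors ((u, 0), (0, c om u)) of the graph lies
    in the graph, so the graph equals its orthogonal. *)
Lemma graph_maximally_isotropic c p : maximally_isotropic p (graph_family c p).
Proof.
split; [exact: graph_csubspace|exact: graph_isotropic|].
move=> W [Wf _ _] iW GW; apply/seteqP; split=> // w Ww.
have [[tw1 cw1] [tw2 cw2]] := Wf _ Ww.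
have test u : tangent p u ->
    w.1.2 u = - c * om p w.2.1 u /\ w.2.2 u = c * om p w.1.1 u.
  move=> tu; have Gu : graph_family c p ((u, 0), (0, c *: om p u)).
    by split=> //=; [exact: tangent0|rewrite (two_form0 tf) scaler0].
  have := iW _ _ (GW _ Gu) Ww.
  rewrite /cpairing /cbilinear_ext /pairing /= => -[].
  rewrite (covec0 cw1) (covec0 cw2) !covec_scaleE.
  rewrite (two_formC tf tu tw1) (two_formC tf tu tw2).
  have E0 v : (0 : covec (M := M)) v = 0 by [].
  by rewrite !E0 => h1 h2; split; lra.
split=> //.
  apply: (cotangent_eq cw1); last by move=> u /test[].
  by apply: cotangentZ; exact: two_form_cotangent.
apply: (cotangent_eq cw2); last by move=> u /test[].
by apply: cotangentZ; exact: two_form_cotangent.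
Qed.

Context (dom : closed_two_form om).

(** L_X (i_Y om) - L_Y (i_X om) + d(om(X, Y)) = i_[X, Y] om for closed om. *)
Lemma lie_form_closed X Y Z p :
  vector_field X -> vector_field Y -> vector_field Z ->
  om p (lie_bracket X Y p) (Z p) =
  lie_form X (fun q => om q (Y q)) Z p - lie_form Y (fun q => om q (X q)) Z p
  + Z p (fun q => om q (X q) (Y q)).
Proof.
move=> vX vY vZ; have := dom vX vY vZ p; rewrite /lie_form.
have tb U V : vector_field U -> vector_field V -> tangent p (lie_bracket U V p).
  by move=> vU vV; exists (lie_bracket U V) => //; exact: vector_field_bracket.
rewrite (vfield_two_formC p vX vZ vY).
have -> : om p (lie_bracket Y Z p) (X p) = - om p (X p) (lie_bracket Y Z p).
  by apply: (two_formC tf); [exact: tb|exists X].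
have -> : om p (lie_bracket Z X p) (Y p) = om p (Y p) (lie_bracket X Z p).
  rewrite (two_formC tf); [|exact: tb|by exists Y].
  rewrite -(covecN (two_form_cotangent tf _)); [|by exists Y|exact: tb].
  by congr (om p _); apply/funext => f; rewrite /lie_bracket; apply: opprB.
by move=> h; lra.
Qed.

(** The map U |-> U + i c om(U) carries the Lie bracket of complex vector
    fields to the Courant bracket. *)
Lemma courant_graph_section c X1 X2 Y1 Y2 :
  vector_field X1 -> vector_field X2 -> vector_field Y1 -> vector_field Y2 ->
  courant (graph_section c X1 X2) (graph_section c Y1 Y2) =
  graph_section c (fun p => lie_bracket X1 Y1 p - lie_bracket X2 Y2 p)
                  (fun p => lie_bracket X1 Y2 p + lie_bracket X2 Y1 p).
Proof.
move=> vX1 vX2 vY1 vY2; apply: courantE.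
have tb U V p : vector_field U -> vector_field V ->
    tangent p (lie_bracket U V p).
  by move=> vU vV; exists (lie_bracket U V) => //; exact: vector_field_bracket.
split.
- apply: (proj1 (Gamma_graph_section c _ _)).
    exact: vector_fieldB (vector_field_bracket vX1 vY1)
                         (vector_field_bracket vX2 vY2).
  exact: vector_fieldD (vector_field_bracket vX1 vY2)
                       (vector_field_bracket vX2 vY1).
- split=> // Z vZ p.
  transitivity (- c * (om p (lie_bracket X1 Y2 p) (Z p)
                       + om p (lie_bracket X2 Y1 p) (Z p))).
    by rewrite /= (two_formD tf); [|exact: tb..].
  rewrite !lie_form_closed//.
  transitivity ((courant_data (fun q => (X1 q, (- c) *: om q (X2 q)))
                              (fun q => (Y1 q, (- c) *: om q (Y2 q)))).2 Z p
              - (courant_data (fun q => (X2 q, c *: om q (X1 q)))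
                              (fun q => (Y2 q, c *: om q (Y1 q)))).2 Z p);
    last by [].
  by rewrite !courant_data_scaled//; field.
- split=> [p|Z vZ p]; first reflexivity.
  transitivity (c * (om p (lie_bracket X1 Y1 p) (Z p)
                     - om p (lie_bracket X2 Y2 p) (Z p))).
    by rewrite /= (two_formB tf); [|exact: tb..].
  rewrite !lie_form_closed//.
  transitivity ((courant_data (fun q => (X1 q, (- c) *: om q (X2 q)))
                              (fun q => (Y2 q, c *: om q (Y1 q)))).2 Z p
              + (courant_data (fun q => (X2 q, c *: om q (X1 q)))
                              (fun q => (Y1 q, (- c) *: om q (Y2 q)))).2 Z p);
    last by [].
  by rewrite !courant_data_scaled//; field.
Qed.

Lemma graph_dirac c : dirac_structure (graph_family c).
Proof.
split; [exact: graph_subbundle|exact: graph_maximally_isotropic|].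
move=> s t /Gamma_graphP[X1 [X2 [vX1 vX2 ->]]].
move=> /Gamma_graphP[Y1 [Y2 [vY1 vY2 ->]]].
rewrite courant_graph_section//; apply: Gamma_graph_section.
  exact: vector_fieldB (vector_field_bracket vX1 vY1)
                       (vector_field_bracket vX2 vY2).
exact: vector_fieldD (vector_field_bracket vX1 vY2)
                     (vector_field_bracket vX2 vY1).
Qed.

End Graphs.

(** * The bundles of a contact form *)

Section ContactStructure.
Local Open Scope classical_set_scope.
Local Open Scope ring_scope.
Context {R : realType} {m : nat} {M : smooth_manifold R m} {n : nat}.
Context (J : contact_tensors M).
Context (gJ : generalized_almost_contact J).
Context (aJ : associated_to_contact_form n J).
Local Notation F := (ct_F J).
Local Notation eta := (ct_eta J).
Local Notation sharp := (ct_pi J).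
Local Notation theta := (ct_theta J).

Lemma vector_field_F : vector_field F.
Proof. by case: gJ => -[]. Qed.

Lemma tangent_F p : tangent p (F p).
Proof. by exists F => //; exact: vector_field_F. Qed.

Lemma one_form_eta : one_form eta.
Proof. by case: gJ => -[]. Qed.

Lemma cotangent_eta p : cotangent p (eta p).
Proof. exact: one_form_eta.1. Qed.

Lemma two_form_theta : two_form theta.
Proof. by case: gJ => -[]. Qed.

Lemma closed_theta : closed_two_form theta.
Proof.
by case: aJ => _ dt _ _ _; exact: exterior_derivative_closed one_form_eta dt.
Qed.

Lemma eta_F p : eta p (F p) = 1.
Proof. by case: aJ => _ _ /(_ p)[]. Qed.

Lemma theta_F p : theta p (F p) = 0.
Proof. by case: aJ => _ _ /(_ p)[]. Qed.

Lemma tangent_sharp p a : cotangent p a -> tangent p (sharp p a).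
Proof. by case: gJ => -[_ _ [+ _ _ _]] _ _ _; exact. Qed.

(** Here phi = 0. *)
Lemma PhiE p x : cotangent p x.2 -> Phi J p x = (sharp p x.2, theta p x.1).
Proof.
move=> cx; have phi0 u : ct_phi J p u = 0 by case: aJ.
rewrite /Phi phi0 add0r; congr pair; apply/funext => u.
rewrite -[RHS]subr0; congr (_ - _).
by rewrite phi0 (covec0 cx).
Qed.

(** The part of Phi o Phi = -1 + F (.) eta on covectors. *)
Lemma theta_sharp p a : cotangent p a ->
  theta p (sharp p a) = - a + a (F p) *: eta p.
Proof.
move=> ca; case: gJ => _ /(_ p)[_ _ _ _ /(_ (0, a))].
rewrite (PhiE (x := (0, a)))//= (two_form0 two_form_theta).
rewrite PhiE/=; last exact: cotangent0.
have g0a : gfiber p (0, a) by split=> //; exact: tangent0.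
by move=> /(_ g0a)/(congr1 snd).
Qed.

(** eta(pi^sharp(a)) = - a(pi^sharp(eta)), and Phi(eta) = 0. *)
Lemma eta_sharp p a : cotangent p a -> eta p (sharp p a) = 0.
Proof.
move=> ca; case: gJ => -[_ _ [_ _ + _] _ _] /(_ p)[_ _ _ + _].
move=> /(_ p a (eta p) ca (cotangent_eta p)) ->.
rewrite PhiE; last exact: cotangent_eta.
by move=> [-> _]; rewrite (covec0 ca) oppr0.
Qed.

(** The component in ker eta of a vector, along the Reeb field. *)
Definition horizontal p (u : tvec (M := M)) := u - eta p u *: F p.

Lemma eta_horizontal p u : tangent p u -> eta p (horizontal p u) = 0.
Proof.
move=> tu; have tF := tangent_F p.
rewrite (covecB (cotangent_eta p))//; last exact: tangentZ.
by rewrite (covecZ (cotangent_eta p))// eta_F mulr1 subrr.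
Qed.

Lemma tangent_horizontal p u : tangent p u -> tangent p (horizontal p u).
Proof. by move=> tu; apply: tangentB => //; apply/tangentZ/tangent_F. Qed.

Lemma theta_horizontal p u : tangent p u ->
  theta p (horizontal p u) = theta p u.
Proof.
move=> tu; have tF := tangent_F p; have tt := two_form_theta.
rewrite (two_formB tt)//; last exact: tangentZ.
by rewrite (two_formZ tt)// theta_F scaler0 subr0.
Qed.

Lemma vector_field_horizontal X : vector_field X ->
  vector_field (fun p => horizontal p (X p)).
Proof.
move=> vX; apply: vector_fieldB => //; apply: vector_fieldM.
  exact: one_form_eta.2.
exact: vector_field_F.
Qed.

Lemma ker_sum_horizontal p u : tangent p u -> ker_sum J p (horizontal p u, 0).
Proof.
move=> tu; split=> //=; last exact: eta_horizontal.
by split; [exact: tangent_horizontal|exact: cotangent0].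
Qed.

Lemma theta_sharp_ker p x : ker_sum J p x -> theta p (sharp p x.2) = - x.2.
Proof.
move=> [[_ cx] _ x0].
by rewrite theta_sharp// x0 scale0r addr0.
Qed.

Lemma sharp0 p : sharp p 0 = 0.
Proof.
case: gJ => -[_ _ [_ lin _ _] _ _] _.
have := lin p (-1) 0 0 (cotangent0 p) (cotangent0 p).
by rewrite scaler0 addr0 scaleN1r addNr.
Qed.

Lemma complex_scaleiE (V : lmodType R) (z : V * V) :
  complex_scale 'i%C z = (- z.2, z.1).
Proof.
by rewrite /complex_scale /=; congr pair; rewrite scale0r ?sub0r ?add0r scale1r.
Qed.

(** The vectors e + i s Phi(e), for e complex in ker eta (+) ker F: this is
    E^(1,0) for s = -1 and E^(0,1) for s = 1. *)
Definition eigenfamily (s : R) : cfamily (M := M) := fun p =>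
  [set (e.1 - s *: Phi J p e.2, e.2 + s *: Phi J p e.1) | e in cker_sum J p].

Lemma E10E : E10 J = eigenfamily (-1).
Proof.
apply/funext => p; congr ([set _ | _ in _]); apply/funext => e.
rewrite complex_scaleiE /cPhi /= !scaleN1r opprK.
by case: e => e1 e2; congr pair; rewrite /= opprK.
Qed.

Lemma E01E : E01 J = eigenfamily 1.
Proof.
apply/funext => p; congr ([set _ | _ in _]); apply/funext => e.
by rewrite complex_scaleiE /cPhi /= !scale1r; case: e.
Qed.

(** With e = x + a, the vector e + i s Phi(e) has tangent part
    U = x + i s pi^sharp(a); as theta(pi^sharp(a)) = - a and s^2 = 1, its form
    part is i s theta(U). *)
Lemma line_F_eigenfamilyE s : s * s = 1 ->
  family_sum (line_F J) (eigenfamily s) = graph_family theta s.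
Proof.
move=> ss; have tt := two_form_theta.
apply/funext => p; apply/seteqP; split=> [z|[[z11 z12] [z21 z22]]].
- move=> [_ [c _ <-] [_ [[[a1 b1] [a2 b2]] /= [k1 k2] <-] ->]].
  have tF := tangent_F p.
  have [sb1 sb2] := (theta_sharp_ker k1, theta_sharp_ker k2).
  have [[[/= ta1 cb1] _ _] [[/= ta2 cb2] _ _]] := (k1, k2).
  have [ts1 ts2] := (tangent_sharp cb1, tangent_sharp cb2).
  rewrite !PhiE//=.
  have t1 : tangent p (complex.Re c *: F p - complex.Im c *: 0
                       + (a1 - s *: sharp p b2)).
    by rewrite scaler0 subr0; apply: tangentD; [exact: tangentZ|];
      apply: tangentB => //; exact: tangentZ.
  have t2 : tangent p (complex.Re c *: 0 + complex.Im c *: F p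
                       + (a2 + s *: sharp p b1)).
    by rewrite scaler0 add0r; apply: tangentD; [exact: tangentZ|];
      apply: tangentD => //; exact: tangentZ.
  have e1 : theta p (complex.Re c *: F p - complex.Im c *: 0
                     + (a1 - s *: sharp p b2)) = theta p a1 + s *: b2.
    rewrite scaler0 subr0 (two_formD tt); [|exact: tangentZ|].
      rewrite (two_formZ tt)// theta_F scaler0 add0r (two_formB tt)//.
        by rewrite (two_formZ tt)// sb2 scalerN opprK.
      exact: tangentZ.
    by apply: tangentB => //; exact: tangentZ.
  have e2 : theta p (complex.Re c *: 0 + complex.Im c *: F p
                     + (a2 + s *: sharp p b1)) = theta p a2 - s *: b1.
    rewrite scaler0 add0r (two_formD tt); [|exact: tangentZ|].
      rewrite (two_formZ tt)// theta_F scaler0 add0r (two_formD tt)//.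
        by rewrite (two_formZ tt)// sb1 scalerN.
      exact: tangentZ.
    by apply: tangentD => //; exact: tangentZ.
  split=> //=.
  + rewrite e2 !scaler0 subr0 add0r scalerDr scalerN scalerA mulNr ss.
    by rewrite !scaleNr scale1r opprK addrC.
  + by rewrite e1 !scaler0 addr0 add0r scalerDr scalerA ss scale1r addrC.
- move=> [/= t1 t2 -> ->].
  exists (complex_scale (Complex (eta p z11) (eta p z21)) ((F p, 0), 0)).
    by exists (Complex (eta p z11) (eta p z21)).
  exists ((horizontal p z11, 0) - s *: Phi J p (horizontal p z21, 0),
          (horizontal p z21, 0) + s *: Phi J p (horizontal p z11, 0)).
    exists ((horizontal p z11, 0), (horizontal p z21, 0)) => //.
    by split; exact: ker_sum_horizontal.
  rewrite !PhiE//=; try exact: cotangent0.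
  rewrite sharp0 !theta_horizontal// /horizontal /complex_scale.
  congr (pair (pair _ _) (pair _ _)); rewrite /=.
  + by rewrite !scaler0 !subr0 addrC subrK.
  + by rewrite !scaler0 subr0 !add0r scaleNr.
  + by rewrite !scaler0 !addr0 add0r addrC subrK.
  + by rewrite !scaler0 !add0r.
Qed.

Lemma L_bundleE : L_bundle J = graph_family theta (-1).
Proof. by rewrite /L_bundle E10E line_F_eigenfamilyE// mulrNN mulr1. Qed.

Lemma Lbar_bundleE : Lbar_bundle J = graph_family theta 1.
Proof. by rewrite /Lbar_bundle E01E line_F_eigenfamilyE// mulr1. Qed.

(** The vector part of the bundles L* and Lbar* lies in ker eta. *)
Lemma eta_line_eta_eigenfamily s p z :
  family_sum (line_eta J) (eigenfamily s) p z -> eta p z.1.1 = 0.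
Proof.
move=> [_ [c _ <-] [_ [[[a1 b1] [a2 b2]] [k1 k2] <-] ->]].
have [[[ta1 cb1] ea1 _] [[ta2 cb2] _ _]] := (k1, k2).
rewrite !PhiE//= !scaler0 subrr add0r.
have ts2 := tangent_sharp cb2.
rewrite (covecB (cotangent_eta p))//; last exact: tangentZ.
by rewrite (covecZ (cotangent_eta p))// eta_sharp// ea1 mulr0 subrr.
Qed.

(** L* and Lbar* contain X + i s theta(X) for X a real field in ker eta. *)
Lemma Gamma_line_eta_eigenfamily s X : vector_field X ->
  Gamma (family_sum (line_eta J) (eigenfamily s))
    (graph_section theta s (fun p => horizontal p (X p)) (fun=> 0)).
Proof.
move=> vX; have tt := two_form_theta; split.
  apply: (proj1 (Gamma_graph_section tt s _ _)).
    exact: vector_field_horizontal.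
  exact: vector_field0.
move=> p; have tX : tangent p (X p) by exists X.
exists 0.
  by exists 0 => //; congr (pair (pair _ _) (pair _ _));
    rewrite /= ?scale0r ?scaler0 ?subrr ?addr0.
exists ((horizontal p (X p), 0) - s *: Phi J p 0,
        0 + s *: Phi J p (horizontal p (X p), 0)).
  exists ((horizontal p (X p), 0), 0) => //; split.
    exact: ker_sum_horizontal.
  by split=> //=; [split; [exact: tangent0|exact: cotangent0]|
    exact: covec0 (cotangent_eta p)].
rewrite !PhiE//=; try exact: cotangent0.
rewrite sharp0 (two_form0 tt) add0r.
congr (pair (pair _ _) (pair _ _)); rewrite /=.
- by rewrite scaler0 subr0.
- by rewrite !(two_form0 tt) !scaler0 subr0.
- by rewrite scaler0 addr0.
- by rewrite add0r.
Qed.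

(** eta([X, Y]) = - d eta(X, Y) for X, Y in ker eta, extended to all fields
    by projecting along F, which lies in the kernel of d eta. *)
Lemma eta_bracket_horizontal X Y p : vector_field X -> vector_field Y ->
  eta p (lie_bracket (fun q => horizontal q (X q))
                     (fun q => horizontal q (Y q)) p) =
  - theta p (X p) (Y p).
Proof.
move=> vX vY; have tt := two_form_theta.
have [vhX vhY] := (vector_field_horizontal vX, vector_field_horizontal vY).
have tX q : tangent q (X q) by exists X.
have tY q : tangent q (Y q) by exists Y.
case: aJ => _ [_ /(_ _ _ vhX vhY p)] + _ _ _.
rewrite theta_horizontal// (two_formC tt)//; last exact: tangent_horizontal.
rewrite theta_horizontal// -(two_formC tt)// => ->.
have eta0 U : vector_field U -> (fun q => eta q (horizontal q (U q))) = cst 0.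
  by move=> vU; apply/funext => q; apply: eta_horizontal; exists U.
have /= zX := vfield0 p vhX; have /= zY := vfield0 p vhY.
by rewrite !eta0// zX zY subrr sub0r opprK.
Qed.

(** If d eta vanished at p, so would eta /\ (d eta)^n, as n > 0. *)
Lemma theta_neq0 : (0 < n)%N -> forall p,
  exists X Y, [/\ vector_field X, vector_field Y & theta p (X p) (Y p) != 0].
Proof.
case: aJ => -[_ [deta [td hd] nd]] [_ ht] _ _ _ n0 p.
apply: contrapT => no.
have z u v : tangent p u -> tangent p v -> deta p u v = 0.
  move=> [X vX <-] [Y vY <-]; rewrite hd// -ht//.
  by apply: contrapT => /eqP ne; apply: no; exists X, Y.
have [v tv] := nd p; case: n n0 nd v tv => [//|k] _ _ v tv.
suff -> : wedge (multiform1 (eta p))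
                (@wedge_exp _ _ _ (multiform2 (deta p)) k.+1) v = 0.
  by rewrite eqxx.
rewrite {1}/wedge big1 ?mulr0// => g _.
rewrite [X in _ * (_ * X)](_ : _ = 0) ?mulr0//.
rewrite /= {1}/wedge big1 ?mulr0// => h _.
by rewrite /multiform2 z// mul0r mulr0.
Qed.

Lemma line_eta_not_courant_closed s : (0 < n)%N -> inhabited M ->
  ~ courant_closed (family_sum (line_eta J) (eigenfamily s)).
Proof.
move=> n0 [p] cl; have [X [Y [vX vY]]] := theta_neq0 n0 p.
have := cl _ _ (Gamma_line_eta_eigenfamily s vX)
  (Gamma_line_eta_eigenfamily s vY).
have [vhX vhY] := (vector_field_horizontal vX, vector_field_horizontal vY).
rewrite (courant_graph_section two_form_theta closed_theta)//;
  try exact: vector_field0.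
move=> [_ /(_ p)/eta_line_eta_eigenfamily] /=.
have -> : lie_bracket (fun=> 0) (fun=> 0) p = 0 :> tvec (M := M).
  by apply/funext => f; rewrite /lie_bracket; exact: subrr.
by rewrite subr0 eta_bracket_horizontal// => /eqP; rewrite oppr_eq0 => ->.
Qed.

End ContactStructure.

Theorem proposition3p1 (R : realType) (n : nat)
    (M : smooth_manifold R (2 * n).+1) (J : contact_tensors M) :
  (0 < n)%N ->
  inhabited M ->
  generalized_almost_contact J ->
  associated_to_contact_form n J ->
  [/\ dirac_structure (L_bundle J),
      dirac_structure (Lbar_bundle J),
      ~ dirac_structure (Lstar_bundle J),
      ~ dirac_structure (Lbarstar_bundle J)
    & ~ lie_bialgebroid (L_bundle J) (Lstar_bundle J)].
Proof.
move=> n0 iM gJ aJ.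
have [tt ct] := (two_form_theta gJ, closed_theta gJ aJ).
have nL s := line_eta_not_courant_closed gJ aJ (s := s) n0 iM.
rewrite (L_bundleE gJ aJ) (Lbar_bundleE gJ aJ) /Lstar_bundle /Lbarstar_bundle.
rewrite E10E E01E.
split; [exact: graph_dirac|exact: graph_dirac|by case=> _ _ /nL..|].
by case=> _ [/nL].
Qed.
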